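(* Let $\mathbf{t}_N$ be a $2$-stable Galton-Watson tree with $N$ vertices, let $b_N=\ell(N)^{-1}N^{-1/2}$, and for $t\in[0,1)$ let $\sigma_N^{\uparrow}(t)$ be the sum of $c(v)-1$ over all ancestors $v$ of the vertex $u(\lfloor Nt\rfloor)$ (including $u(\lfloor Nt\rfloor)$ itself) that are not leaves, with $\sigma_N^{\uparrow}(1)=0$. Assume that the trees are constructed on a probability space on which the convergences of the coding paths recalled in the context hold jointly almost surely. Then $$\sup_{t\in[0,1]}\left|b_N\sigma_N^{\uparrow}(t)-2X_2(t)\right|\longrightarrow0\quad\text{as }N\to\infty,\ \text{almost surely}.$$
   Context: **Trees.** The offspring law $\eta=(\eta(k))_{k\ge0}$ is critical ($\sum_k k\eta(k)=1$), aperiodic, with $\eta(0)>0$, $\eta(0)+\eta(1)<1$, and is in the domain of attraction of a stable law of index $2$: either $\eta$ has finite variance, or $\eta([k,\infty))=k^{-2}L(k)$ with $L:\mathbb{R}_+\to\mathbb{R}_+$ slowly varying. The $2$-stable GW-tree $\mathbf{t}_N$ is the Galton-Watson tree (a rooted plane tree) with offspring law $\eta$ conditioned to have $N$ vertices. $c(v)$ is the number of children of $v$; a leaf is a vertex with $c(v)=0$. **Coding paths.** Let $u(0),\dots,u(N-1)$ be the vertices of $\mathbf{t}_N$ in lexicographical (depth-first) order, and let $W_N^{\uparrow}(0)=0$, $W_N^{\uparrow}(n+1)=W_N^{\uparrow}(n)+c(u(n))-1$ for $0\le n\le N-1$ ($\L$ukasiewicz path). $W_N^{\downarrow}$ is defined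 in the same way using the reverse-lexicographical order (depth-first order in which children are visited from right to left). $\Delta W_N^{\uparrow}(k+1)=W_N^{\uparrow}(k+1)-W_N^{\uparrow}(k)$. Equivalently to the definition in the claim, for $t\in[0,1)$, $\sigma_N^{\uparrow}(t)=\sum_k\Delta W_N^{\uparrow}(k+1)-\big(\Delta W_N^{\uparrow}(\lfloor Nt\rfloor+1)\wedge0\big)$, the sum being over all $k$ such that $u(k)$ is an ancestor of, or equal to, $u(\lfloor Nt\rfloor)$. The height process is $H_N(n)=|u(n)|$ (the distance of $u(n)$ to the root), linearly interpolated. The contour process $C_N$ is the linearly interpolated sequence of distances to the root of the vertices visited by the contour exploration of $\mathbf{t}_N$ (of length $2(N-1)$). **Coupling.** There is a slowly varying $\ell:\mathbb{R}_+\to\mathbb{R}_+$ such that, with $a_N=\ell(N)N^{1/2-1}$ and $b_N=\ell(N)^{-1}N^{-1/2}$, jointly in distribution as $N\to\infty$, $$\big(a_NC_N(2(N-1)t),\,a_NH_N((N-1)t),\,b_NW_N^{\uparrow}(\lfloor Nt\rfloor),\,b_NW_N^{\downarrow}(\lfloor Nt\rfloor)\big)_{t\in[0,1]}\to\big(2X_2(t),\,2X_2(t),\,X_2(t),\,\tilde X_2(t)\big)_{t\in[0,1]},$$ where $X_2$ is the standard normalized Brownian excursion and $\tilde X_2(t)=X_2(1-t)$; the first two coordinates converge in the space of continuous functions with the uniform topology, and the last two in the Skorohod space $\mathbb{D}([0,1],\mathbb{R})$ with the $\mathrm{J}_1$ topology. By Skorokhod's representation theorem, everything is assumed to be defined on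 one probability space where this convergence holds almost surely. *)

(* Defs.v *)
From HB Require Import structures.
From mathcomp Require Import all_boot all_order all_algebra.
From mathcomp Require Import all_classical all_reals all_analysis.

Set Implicit Arguments.
Unset Strict Implicit.
Unset Printing Implicit Defensive.

Import Order.TTheory GRing.Theory Num.Theory.
Import numFieldNormedType.Exports.

Local Open Scope classical_set_scope.
Local Open Scope ring_scope.

Inductive plane_tree : Type := Node of seq plane_tree.

HB.instance Definition _ := gen_eqMixin plane_tree.
HB.instance Definition _ := gen_choiceMixin plane_tree.

(* Vertices are Ulam-Harris words: the root is [::], and the children of v are
   rcons v 0, rcons v 1, ... from left to right.  Hence |v| = size v, and the
   ancestors of v, including v itself, are the prefixes of v. *)
Definition vertex : Type := seq nat.

(* Given one list of words for each child of the root, shift the words of the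
   i-th list below the i-th child. *)
Definition below_root (vss : seq (seq vertex)) : seq (seq vertex) :=
  mkseq (fun i => [seq i :: v | v <- nth [::] vss i]) (size vss).

Fixpoint lex_vertices (t : plane_tree) : seq vertex :=
  let: Node ts := t in
  [::] :: flatten (below_root (map lex_vertices ts)).

Fixpoint revlex_vertices (t : plane_tree) : seq vertex :=
  let: Node ts := t in
  [::] :: flatten (rev (below_root (map revlex_vertices ts))).

(* The walk around the tree returns to the root after each child's subtree; it
   visits 2 (N - 1) + 1 vertices (with repetitions) when t has N vertices. *)
Fixpoint contour_vertices (t : plane_tree) : seq vertex :=
  let: Node ts := t in
  [::] :: flatten [seq rcons vs [::]
                  | vs <- below_root (map contour_vertices ts)].

Definition nvertices (t : plane_tree) : nat := size (lex_vertices t).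

(* c(v); the value at words v that are not vertices of t is irrelevant. *)
Fixpoint nchildren (t : plane_tree) (v : vertex) : nat :=
  let: Node ts := t in
  if v is i :: v' then nchildren (nth (Node [::]) ts i) v' else size ts.

Section CodingPaths.
Variable R : realType.
Implicit Types (t : plane_tree) (x : R) (n : nat).

Fixpoint walk (s : nat -> R) n : R :=
  if n is m.+1 then walk s m + s m else 0.

Definition luka_up t n : R :=
  walk (fun k => (nchildren t (nth [::] (lex_vertices t) k))%:R - 1) n.

Definition luka_down t n : R :=
  walk (fun k => (nchildren t (nth [::] (revlex_vertices t) k))%:R - 1) n.

Definition linear_interp (s : nat -> R) x : R :=
  let n := Num.truncn x in s n + (x - n%:R) * (s n.+1 - s n).

Definition height t : R -> R :=
  linear_interp (fun n => (size (nth [::] (lex_vertices t) n))%:R).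

Definition contour t : R -> R :=
  linear_interp (fun n => (size (nth [::] (contour_vertices t) n))%:R).

Definition sigma_up t (N : nat) x : R :=
  if x < 1 then
    \sum_(v <- lex_vertices t |
            prefix v (nth [::] (lex_vertices t) (Num.truncn (N%:R * x)))
            && (nchildren t v != 0)%N)
       ((nchildren t v)%:R - 1)
  else 0.

End CodingPaths.

Section GaltonWatson.
Variable R : realType.

(* Values of L on negative arguments are irrelevant.  Since 0^-1 = 0, the limit
   forces L to be positive near +oo. *)
Definition slowly_varying (L : R -> R) : Prop :=
  [/\ forall x, 0 <= x -> 0 <= L x,
      measurable_fun (`[0, +oo[ : set R) L &
      forall c : R, 0 < c -> (L (c * x) / L x) @[x --> +oo] --> (1 : R)].

Definition finite_variance (eta : nat -> R) : Prop :=
  (\sum_(k <oo) (k%:R ^+ 2 * eta k)%:E < +oo)%E.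

Definition regularly_varying_tail2 (eta : nat -> R) : Prop :=
  exists2 L : R -> R, slowly_varying L &
    forall k : nat, (0 < k)%N ->
      (\sum_(k <= j <oo) (eta j)%:E = ((k%:R ^- 2) * L k%:R)%:E)%E.

Record critical_stable2_offspring (eta : nat -> R) : Prop := {
  offspring_ge0 : forall k, 0 <= eta k;
  offspring_sum1 : (\sum_(k <oo) (eta k)%:E = 1)%E;
  offspring_critical : (\sum_(k <oo) (k%:R * eta k)%:E = 1)%E;
  offspring_aperiodic :
    forall d : nat, (forall k, 0 < eta k -> (d %| k)%N) -> d = 1%N;
  offspring_eta0 : 0 < eta 0%N;
  offspring_eta01 : eta 0%N + eta 1%N < 1;
  offspring_stable2 : finite_variance eta \/ regularly_varying_tail2 eta
}.

(* Probability that the unconditioned Galton-Watson tree equals t. *)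
Definition gw_prob (eta : nat -> R) (t : plane_tree) : R :=
  \prod_(v <- lex_vertices t) eta (nchildren t v).

Definition gw_size_prob (eta : nat -> R) (N : nat) : \bar R :=
  (\esum_(t in [set t | nvertices t = N]) (gw_prob eta t)%:E)%E.

(* tree N is a Galton-Watson tree conditioned to have N vertices, for every N
   for which the conditioning event has positive probability. *)
Definition conditioned_gw_trees d (Omega : measurableType d)
    (P : probability Omega R) (eta : nat -> R)
    (tree : nat -> Omega -> plane_tree) : Prop :=
  forall N : nat, (0 < gw_size_prob eta N)%E ->
  forall t : plane_tree,
    measurable [set w | tree N w = t] /\
    P [set w | tree N w = t] =
      (if nvertices t == N then gw_prob eta t / fine (gw_size_prob eta N)
       else 0)%:E.

End GaltonWatson.

Section BrownianExcursion.
Variable R : realType.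
Implicit Types (s t x y : R).

(* Density at t of the first hitting time of 0 by Brownian motion started
   at x > 0. *)
Definition hitting_density t x : R :=
  x / Num.sqrt (2 * pi * t ^+ 3) * expR (- (x ^+ 2 / (2 * t))).

(* Transition density of Brownian motion killed at 0, for x, y > 0. *)
Definition killed_density t x y : R :=
  (expR (- ((x - y) ^+ 2 / (2 * t))) - expR (- ((x + y) ^+ 2 / (2 * t))))
    / Num.sqrt (2 * pi * t).

Fixpoint excursion_mass (A : R -> set R) s x (ts : seq R) : \bar R :=
  if ts is t :: ts' then
    (\int[lebesgue_measure]_(y in A t `&` `]0%R, +oo[)
       ((killed_density (t - s) x y)%:E * excursion_mass A t y ts'))%E
  else (hitting_density (1 - s) x)%:E.

(* Finite-dimensional marginals: for 0 < t1 < ... < tk < 1, (X t1, ..., X tk)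
   has on (0, +oo)^k the density
     2 sqrt(2 pi) q_{t1}(x1) p_{t2 - t1}(x1, x2) ...
       p_{tk - t(k-1)}(x(k-1), xk) q_{1 - tk}(xk),
   q being the hitting density and p the killed density. *)
Definition excursion_fdd (A : R -> set R) (ts : seq R) : \bar R :=
  if ts is t :: ts' then
    (\int[lebesgue_measure]_(y in A t `&` `]0%R, +oo[)
       ((2 * Num.sqrt (2 * pi) * hitting_density t y)%:E
          * excursion_mass A t y ts'))%E
  else 1%E.

Record brownian_excursion d (Omega : measurableType d)
    (P : probability Omega R) (X : Omega -> R -> R) : Prop := {
  excursion_measurable :
    forall t, t \in `[0, 1] -> measurable_fun setT (fun w => X w t);
  excursion_paths :
    \forall w \ae P,
      [/\ {within `[0, 1], continuous (X w)}, X w 0 = 0 & X w 1 = 0];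
  excursion_law :
    forall (ts : seq R) (A : R -> set R),
      path <%R 0 (rcons ts 1) -> (forall t, measurable (A t)) ->
      P [set w | forall t, t \in ts -> A t (X w t)] = excursion_fdd A ts
}.

End BrownianExcursion.

Section CodingConvergence.
Variable R : realType.

Definition time_change (lambda : R -> R) : Prop :=
  set_bij `[0, 1] `[0, 1] lambda /\
  {in `[0, 1] &, {homo lambda : x y / x < y}}.

(* Skorokhod J1 convergence on [0, 1], through time changes tending to the
   identity. *)
Definition J1_cvg (f_ : nat -> R -> R) (f : R -> R) : Prop :=
  exists lambda : nat -> R -> R,
    [/\ forall n, time_change (lambda n),
        {uniform `[0, 1], lambda @ \oo --> (id : R -> R)} &
        {uniform `[0, 1], (fun n => f_ n \o lambda n) @ \oo --> f}].

Definition scale_a (ell : R -> R) (N : nat) : R :=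
  ell N%:R * N%:R `^ (2^-1 - 1).

Definition scale_b (ell : R -> R) (N : nat) : R :=
  (ell N%:R)^-1 * N%:R `^ (- 2^-1).

Definition coding_paths_cvg (ell : R -> R) (tree : nat -> plane_tree)
    (X : R -> R) : Prop :=
  [/\ {uniform `[0, 1],
        (fun N t => scale_a ell N * contour (tree N) (2 * N.-1%:R * t)) @ \oo
        --> (fun t => 2 * X t)},
      {uniform `[0, 1],
        (fun N t => scale_a ell N * height (tree N) (N.-1%:R * t)) @ \oo
        --> (fun t => 2 * X t)},
      J1_cvg (fun N t =>
        scale_b ell N * luka_up R (tree N) (Num.truncn (N%:R * t))) X &
      J1_cvg (fun N t =>
        scale_b ell N * luka_down R (tree N) (Num.truncn (N%:R * t)))
        (fun t => X (1 - t))].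

End CodingConvergence.

(* Main.v *)
(* Let [u] be the vertex of index [n], let [n'] be its index in reverse order
   and [m] the index of the first vertex after its subtree.  The Lukasiewicz
   paths count the siblings branching off to the right and to the left of the
   ancestral line of [u], so the sum of [c(v) - 1] over the strict ancestors of
   [u] is [up n + down n'], where [n' + m = N + |u|] and [up m = up n - 1].
   As [up N = -1] and [X 1 = 0], [b_N] tends to 0; as [a_N * b_N * N = 1], the
   heights are then negligible with respect to [N].  Hence
     [b_N down n' ~ X (1 - n' / N) = X ((m - |u|) / N) ~ X (m / N)
        ~ b_N up m = b_N (up n - 1) ~ X (n / N)],
   although [m - n], the size of the subtree of [u], need not be negligible.
   The contribution of [u] itself is at most one jump of the path, which is
   negligible because [X] is continuous.

   The conditioning gives [tree N] exactly [N] vertices only if that event has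
   positive probability; by aperiodicity this holds for all large [N]. *)
Require Import Defs.
From HB Require Import structures.
From mathcomp Require Import all_boot all_order all_algebra zify ring lra.
From mathcomp Require Import all_classical all_reals all_analysis.

Set Implicit Arguments.
Unset Strict Implicit.
Unset Printing Implicit Defensive.

Import Order.TTheory GRing.Theory Num.Theory.
Import numFieldNormedType.Exports.

Local Open Scope classical_set_scope.
Local Open Scope ring_scope.

(** * Decomposition along the ancestral line *)

(** The recursion passes through [seq], so a hypothesis on every child has to be supplied; it goes
    by index because children are letters of words. *)
Lemma plane_tree_nested_ind (Q : plane_tree -> Prop) :
  (forall ts, (forall i, (i < size ts)%N -> Q (nth (Node [::]) ts i)) ->
     Q (Node ts)) -> forall t, Q t.
Proof.
move=> step.
have nil_step i : (i < 0)%N -> Q (nth (Node [::]) [::] i) by rewrite ltn0.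
fix IH 1 => -[ts]; apply: step; elim: ts => [|t ts IHts] i; first exact: nil_step.
case: i => [_|i] /=; first exact: IH.
exact: IHts.
Qed.

Definition child (ts : seq plane_tree) i := nth (Node [::]) ts i.

Lemma below_rootE (f : plane_tree -> seq vertex) ts :
  below_root (map f ts) =
  [seq [seq i :: v | v <- f (child ts i)] | i <- iota 0 (size ts)].
Proof.
rewrite /below_root /mkseq size_map; apply/eq_in_map => i.
by rewrite mem_iota add0n => /andP[_ lti]; rewrite (nth_map (Node [::])).
Qed.

Lemma lex_vertices_Node ts : lex_vertices (Node ts) = [::] ::
  flatten [seq [seq i :: v | v <- lex_vertices (child ts i)]
          | i <- iota 0 (size ts)].
Proof. by rewrite /= below_rootE. Qed.

Lemma revlex_vertices_Node ts : revlex_vertices (Node ts) = [::] ::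
  flatten [seq [seq i :: v | v <- revlex_vertices (child ts i)]
          | i <- rev (iota 0 (size ts))].
Proof. by rewrite /= below_rootE map_rev. Qed.

Lemma perm_flatten_map (T : eqType) (I : eqType) (f g : I -> seq T) s1 s2 :
  perm_eq s1 s2 -> (forall i, i \in s1 -> perm_eq (f i) (g i)) ->
  perm_eq (flatten (map f s1)) (flatten (map g s2)).
Proof.
move=> s12 fg; apply: (@perm_trans _ (flatten (map g s1))); last first.
  by apply: perm_flatten; rewrite perm_map.
elim: s1 {s12} fg => //= i s IH fg; apply: perm_cat.
  by apply: fg; rewrite mem_head.
by apply: IH => j js; apply: fg; rewrite in_cons js orbT.
Qed.

Lemma perm_revlex_vertices t : perm_eq (revlex_vertices t) (lex_vertices t).
Proof.
elim/plane_tree_nested_ind: t => ts IH.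
rewrite lex_vertices_Node revlex_vertices_Node perm_cons.
apply: perm_flatten_map => [|i]; first by rewrite perm_rev.
rewrite mem_rev mem_iota add0n => /andP[_ lti].
by apply: perm_map; apply: IH.
Qed.

Section Excess.
Variable R : realType.

Definition excess t v : R := (nchildren t v)%:R - 1.

Definition total_excess t s : R := \sum_(v <- s) excess t v.

Lemma total_excess_cat t s1 s2 :
  total_excess t (s1 ++ s2) = total_excess t s1 + total_excess t s2.
Proof. by rewrite /total_excess big_cat. Qed.

Lemma total_excess_root ts s :
  total_excess (Node ts) ([::] :: s) =
  (size ts)%:R - 1 + total_excess (Node ts) s.
Proof. by rewrite /total_excess big_cons. Qed.

Lemma total_excess_below ts i s :
  total_excess (Node ts) [seq i :: v | v <- s] = total_excess (child ts i) s.
Proof. by rewrite /total_excess big_map. Qed.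

(** Each subtree contributes -1. Leaving the order [f] and the list [s] of children free covers both
    orders, and the siblings on one side of a child. *)
Lemma total_excess_forest ts (f : plane_tree -> seq vertex) s :
  (forall i, i \in s -> total_excess (child ts i) (f (child ts i)) = -1) ->
  total_excess (Node ts)
    (flatten [seq [seq i :: v | v <- f (child ts i)] | i <- s]) =
  - (size s)%:R.
Proof.
elim: s => [_|i s IH fE] /=; first by rewrite /total_excess big_nil oppr0.
rewrite total_excess_cat total_excess_below fE ?mem_head// IH; last first.
  by move=> j js; apply: fE; rewrite in_cons js orbT.
by rewrite -natr1; ring.
Qed.

Lemma total_excess_lex t : total_excess t (lex_vertices t) = -1.
Proof.
elim/plane_tree_nested_ind: t => ts IH.
rewrite lex_vertices_Node total_excess_root total_excess_forest.
  by rewrite size_iota; ring.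
by move=> i; rewrite mem_iota add0n => /andP[_]; apply: IH.
Qed.

Lemma total_excess_revlex t : total_excess t (revlex_vertices t) = -1.
Proof.
rewrite -(total_excess_lex t); exact/perm_big/perm_revlex_vertices.
Qed.

(** Past the end of [s] the walk would go on reading the default word [[::]], the root; hence the
    bound on [n]. *)
Lemma walkE t (s : seq vertex) n : (n <= size s)%N ->
  walk (fun k => (nchildren t (nth [::] s k))%:R - 1 : R) n =
  total_excess t (take n s).
Proof.
elim: n => [_|n IH ltn]; first by rewrite take0 /total_excess big_nil.
by rewrite /= IH ?(ltnW ltn)// (take_nth [::] ltn) -cats1 total_excess_cat
  /total_excess big_seq1.
Qed.

Definition ancestral_excess t u : R :=
  \sum_(v <- lex_vertices t | prefix v u && (nchildren t v != 0)%N) excess t v.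

(** A prefix of [i :: u] in this list starts with the letter [i], and [uniq s] makes the block of
    [i] occur only once. *)
Lemma big_forest_child ts i (u : vertex) (P : pred vertex) (F : vertex -> R) s :
  uniq s -> i \in s ->
  \sum_(v <- flatten [seq [seq j :: v | v <- lex_vertices (child ts j)]
                     | j <- s] | prefix v (i :: u) && P v) F v =
  \sum_(v <- lex_vertices (child ts i) | prefix v u && P (i :: v)) F (i :: v).
Proof.
move=> us si; rewrite big_flatten big_map (bigD1_seq i)//= big_map.
rewrite [X in _ + X]big1 ?addr0; last first.
  move=> j ji; rewrite big_map big1// => v.
  by rewrite /= (negbTE ji).
by apply: eq_bigl => v /=; rewrite eqxx.
Qed.

Lemma ancestral_excess_root t :
  ancestral_excess t [::] =
  (if nchildren t [::] == 0%N then 0 else excess t [::]).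
Proof.
case: t => ts; rewrite /ancestral_excess lex_vertices_Node big_cons.
rewrite big_flatten big_map big1.
  by rewrite addr0 /=; case: (size ts).
by move=> j _; rewrite big_map big1.
Qed.

Lemma ancestral_excess_cons ts i u : (i < size ts)%N ->
  ancestral_excess (Node ts) (i :: u) =
  (size ts)%:R - 1 + ancestral_excess (child ts i) u.
Proof.
move=> lti; rewrite /ancestral_excess lex_vertices_Node big_cons.
rewrite (@big_forest_child _ i u (fun v => nchildren (Node ts) v != 0%N))//=.
- by rewrite -lt0n (leq_ltn_trans _ lti).
- exact: iota_uniq.
- by rewrite mem_iota.
Qed.

(** Position [n] of the concatenation is position [p] of block [i]; the start [a] varies for the
    induction. *)
Lemma flatten_map_split (T : Type) (F : nat -> seq T) a k n :
  (n < size (flatten (map F (iota a k))))%N ->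
  exists i p, [/\ (i < k)%N, (p < size (F (a + i)))%N &
    n = (size (flatten (map F (iota a i))) + p)%N].
Proof.
elim: k a n => [//|k IH] a n /=; rewrite size_cat => ltn.
have [lt|le] := ltnP n (size (F a)).
  by exists 0%N, n; rewrite addn0.
have [|i [p [lti ltp E]]] := IH a.+1 (n - size (F a))%N; first lia.
exists i.+1, p; rewrite addnS -addSn ltp /= size_cat; split=> //; lia.
Qed.

(* [n'] is the index of [u] in reverse order, and [m] that of the first vertex
   after the subtree of [u]. *)
Lemma ancestral_excess_decomposition t n :
  (n < nvertices t)%N ->
  let u := nth [::] (lex_vertices t) n in
  exists n' m, [/\ (n' <= nvertices t)%N, (m <= nvertices t)%N,
    (n' + m = nvertices t + size u)%N,
    total_excess t (take m (lex_vertices t)) =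
      total_excess t (take n (lex_vertices t)) - 1 &
    ancestral_excess t u = total_excess t (take n (lex_vertices t)) +
      total_excess t (take n' (revlex_vertices t)) +
      (if nchildren t u == 0%N then 0 else excess t u)].
Proof.
rewrite /nvertices; elim/plane_tree_nested_ind: t n => ts IH [_|n].
  have -> : nth [::] (lex_vertices (Node ts)) 0 = [::] by [].
  (* The root comes first in both orders, and its subtree is the whole tree. *)
  exists 0%N, (size (lex_vertices (Node ts))); split=> //.
  - by rewrite addn0.
  - by rewrite take_size total_excess_lex take0 /total_excess big_nil sub0r.
  - by rewrite ancestral_excess_root !take0 /total_excess !big_nil !add0r.
rewrite lex_vertices_Node revlex_vertices_Node [size (_ :: _)]/= ltnS.
move=> /flatten_map_split [i [p [lti ltp ->]]].
rewrite add0n in ltp *.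
have [] := IH i lti p; first by rewrite size_map in ltp.
rewrite -/(child ts i); set c := child ts i in ltp *.
move=> n' [m [n'N mN nmE upE ancE]].
have iotaE : iota 0 (size ts) = iota 0 i ++ i :: iota i.+1 (size ts - i.+1).
  rewrite -[i :: _]/(iota i (size ts - i.+1).+1) -{2}[i]add0n -iotaD.
  by congr iota; lia.
rewrite iotaE rev_cat rev_cons -cats1 !map_cat !flatten_cat /= cats0 -/c -!catA.
(* [L], [M], [R'] list the vertices to the left of child [i], below it, and to its right; [revR],
   [revM], [revL] are their reverse-order counterparts. *)
set L : seq vertex := flatten _.
set M : seq vertex := [seq i :: v | v <- lex_vertices c].
set R' : seq vertex := flatten [seq _ | i <- iota i.+1 _].
set revR : seq vertex := flatten [seq _ | i <- rev (iota i.+1 _)].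
set revM : seq vertex := [seq i :: v | v <- revlex_vertices c].
set revL : seq vertex := flatten _.
have sRE : size revR = size R'.
  apply/perm_size/perm_flatten_map => [|j _]; first by rewrite perm_rev.
  exact/perm_map/perm_revlex_vertices.
have sM : size M = size (lex_vertices c) by rewrite size_map.
have srM : size revM = size (lex_vertices c).
  by rewrite size_map (perm_size (perm_revlex_vertices c)).
have takeM k T (l1 l2 l3 : seq T) : (k <= size l2)%N ->
    take (size l1 + k)%N (l1 ++ l2 ++ l3) = l1 ++ take k l2.
  by move=> le; rewrite take_cat ltnNge leq_addr /= addKn takel_cat.
have nthM : nth [::] (L ++ M ++ R') (size L + p) =
    i :: nth [::] (lex_vertices c) p.
  rewrite nth_cat ltnNge leq_addr /= addKn nth_cat ltp.
  by rewrite (nth_map [::]) // -sM.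
have EL : total_excess (Node ts) L = - i%:R.
  rewrite /L total_excess_forest ?size_iota// => j _; exact: total_excess_lex.
have ER : total_excess (Node ts) revR = - (size ts - i.+1)%:R.
  rewrite /revR total_excess_forest ?size_rev ?size_iota// => j _.
  exact: total_excess_revlex.
(* In each order the root and the subtrees on one side come first. Of the two units, one completes
   the vertex count and the other is the extra level of [u]. *)
exists (size revR + n').+1, (size L + m).+1.
rewrite /= nthM !size_cat /= !takeM ?sM ?srM //; last by rewrite ltnW // -sM.
split; [lia|lia|lia| |].
- rewrite !total_excess_root !total_excess_cat /M -!map_take.
  by rewrite !total_excess_below upE; ring.
(* With k children, the root is counted in both orders, giving 2 (k - 1), and the subtrees of the
   siblings take off i + (k - i - 1) = k - 1. *)
- rewrite ancestral_excess_cons// ancE !total_excess_root !total_excess_cat.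
  rewrite /M /revM -!map_take !total_excess_below EL ER natrB//.
  rewrite /excess /= -/(child ts i) -/c -natr1; case: ifP => _; ring.
Qed.

End Excess.

(** * Size of the conditioned trees *)

(* The least gap [d] between two elements divides every element: otherwise
   [q (m + d)] and [q m + s], with [q = s %/ d], have the smaller gap [s %% d].
   Hence [d = 1], and consecutive elements [m], [m + 1] generate all [n >= m^2]. *)
Lemma numerical_semigroup_cofinite (G : nat -> Prop) :
  G 0%N -> (forall m n, G m -> G n -> G (m + n)%N) ->
  (forall d, (forall k, G k -> (d %| k)%N) -> d = 1%N) ->
  exists n0, forall n, (n0 <= n)%N -> G n.
Proof.
move=> G0 GD Ggcd.
have GM q m : G m -> G (q * m)%N.
  by move=> Gm; elim: q => [//|q IH]; rewrite mulSn; apply: GD.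
pose gap d := `[< (0 < d)%N /\ exists m, G m /\ G (m + d)%N >].
(* If 0 were the only element, [d = 0] would divide all of them. *)
have [k k0 Gk] : exists2 k, (0 < k)%N & G k.
  apply: contrapT => nG; suff : 0%N = 1%N by [].
  apply: Ggcd => -[//|k] Gk; exfalso; apply: nG; by exists k.+1.
have gapex : exists d, gap d.
  by exists k; apply/asboolP; split=> //; exists 0%N.
case: (ex_minnP gapex) => d /asboolP[d0 [m [Gm Gmd]]] dmin.
have d1 : d = 1%N.
  apply: Ggcd => s Gs; rewrite /dvdn; apply: contraT; rewrite -lt0n => r0.
  have /dmin : gap (s %% d)%N.
    apply/asboolP; split=> //; exists (s %/ d * (m + d))%N; split; first exact: GM.
    rewrite (_ : _ + _ = s %/ d * m + s)%N; first by apply: GD => //; apply: GM.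
    by rewrite mulnDr -addnA -divn_eq.
  by rewrite leqNgt ltn_mod d0.
rewrite {}d1 in Gmd.
exists (m * m)%N => n le.
have [m0|m0] := posnP m.
  by rewrite m0 in Gmd; rewrite -[n]muln1; apply: GM.
have lt := ltn_pmod n m0.
(* The quotient thus exceeds the remainder, so the subtraction below is not truncated. *)
have qm : (m <= n %/ m)%N by rewrite leq_divRL.
rewrite (_ : n = (n %/ m - n %% m) * m + n %% m * (m + 1))%N.
  by apply: GD; apply: GM.
rewrite mulnBl mulnDr muln1 addnA subnK -?divn_eq//.
by rewrite leq_mul2r; apply/orP; right; lia.
Qed.

Lemma all_nchildren_Node (Q : pred nat) ts :
  all (fun v => Q (nchildren (Node ts) v)) (lex_vertices (Node ts)) =
  Q (size ts) &&
  all (fun t => all (fun v => Q (nchildren t v)) (lex_vertices t)) ts.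
Proof.
rewrite lex_vertices_Node /=; congr andb.
have -> (ss : seq (seq vertex)) q : all q (flatten ss) = all (all q) ss.
  by elim: ss => //= s ss <-; rewrite all_cat.
rewrite all_map -[in RHS](mkseq_nth (Node [::]) ts) all_map.
by apply: eq_all => i /=; rewrite all_map.
Qed.

Lemma nvertices_Node ts : nvertices (Node ts) = (sumn (map nvertices ts)).+1.
Proof.
rewrite /nvertices lex_vertices_Node /= size_flatten /shape -map_comp.
congr (sumn _).+1.
rewrite -[in RHS](mkseq_nth (Node [::]) ts) -map_comp.
by apply: eq_map => i /=; rewrite size_map.
Qed.

(** Each nonzero entry [k] puts a new root above the tree built so far, with [k - 1] leaves as
    further children, which adds [k] vertices. Zero entries are skipped. *)
Lemma caterpillar_exists (Q : pred nat) ks : Q 0%N -> all Q ks ->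
  exists t, nvertices t = (sumn ks).+1 /\
    all (fun v => Q (nchildren t v)) (lex_vertices t).
Proof.
move=> Q0; elim: ks => [_|k ks IH /= /andP[Qk /IH[t [tE Qt]]]].
  by exists (Node [::]); split=> //=; rewrite Q0.
case: k Qk => [_|k Qk]; first by exists t.
exists (Node (t :: nseq k (Node [::]))); split.
  rewrite nvertices_Node /= tE map_nseq sumn_nseq.
  by rewrite (_ : nvertices _ = 1%N)// mul1n; congr _.+1; lia.
by rewrite all_nchildren_Node /= size_nseq Qk Qt /= all_nseq /= Q0 orbT.
Qed.

(** Sums of offspring numbers of positive weight form a semigroup, cofinite by aperiodicity. A
    single caterpillar then gives positive mass to its size. *)
Lemma gw_size_prob_gt0 (R : realType) (eta : nat -> R) :
  critical_stable2_offspring eta ->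
  exists N0, forall N, (N0 <= N)%N -> (0 < gw_size_prob eta N)%E.
Proof.
move=> heta.
pose Q k := 0 < eta k.
have [] := @numerical_semigroup_cofinite
  (fun n => exists ks, all Q ks /\ sumn ks = n).
- by exists [::].
- move=> m n [ks [Qks <-]] [ls [Qls <-]].
  by exists (ks ++ ls); rewrite all_cat Qks Qls sumn_cat.
- move=> d dG; apply: (offspring_aperiodic heta) => k etak.
  by apply: dG; exists [:: k]; rewrite /= addn0 andbT.
move=> n0 n0G; exists n0.+1 => -[//|N] /n0G[ks [Qks sumE]].
have [t [tE Qt]] := @caterpillar_exists Q _ (offspring_eta0 heta) Qks.
apply: (@lt_le_trans _ _ (gw_prob eta t)%:E).
  rewrite lte_fin /gw_prob big_seq; apply: prodr_gt0 => v vt.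
  exact: (allP Qt).
apply: esum_ge; exists [set t]; last by rewrite fsbig_set1.
split; first exact: finite_set1.
by move=> _ /= ->; rewrite tE sumE.
Qed.

(** An embedding into a countable type, with dummy label 0, in order to enumerate plane trees. *)
Fixpoint encode_tree (t : plane_tree) : GenTree.tree nat :=
  let: Node ts := t in GenTree.Node 0 (map encode_tree ts).

Fixpoint decode_tree (g : GenTree.tree nat) : plane_tree :=
  if g is GenTree.Node _ gs then Node (map decode_tree gs) else Node [::].

Lemma encode_treeK : cancel encode_tree decode_tree.
Proof.
elim/plane_tree_nested_ind => ts IH /=; congr Node; rewrite -map_comp.
apply: (@eq_from_nth _ (Node [::])); rewrite size_map// => i lti.
by rewrite (nth_map (Node [::])) //= IH.
Qed.

Lemma plane_tree_enumeration :
  exists e : nat -> plane_tree, forall t, exists k, e k = t.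
Proof.
exists (fun k => oapp decode_tree (Node [::]) (unpickle k)) => t.
by exists (pickle (encode_tree t)); rewrite pickleK /= encode_treeK.
Qed.

(** For each large [N] the exceptional event is covered by countably many null events, one for each
    tree of the wrong size. *)
Lemma ae_nvertices (R : realType) (d : measure_display)
    (Omega : measurableType d) (P : probability Omega R)
    (eta : nat -> R) (tree : nat -> Omega -> plane_tree) :
  critical_stable2_offspring eta -> conditioned_gw_trees P eta tree ->
  \forall w \ae P, \forall N \near \oo, nvertices (tree N w) = N.
Proof.
move=> heta htree; have [N0 N0P] := gw_size_prob_gt0 heta.
suff : \forall w \ae P, forall N, (N0 <= N)%N -> nvertices (tree N w) = N.
  apply: filterS => w wP; exists N0 => // N /=; exact: wP.
apply: ae_foralln => N.
have [le|lt] := leqP N0 N; last by apply: aeW.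
have htreeN := htree N (N0P N le).
have [e eP] := plane_tree_enumeration.
suff : P.-negligible
    (\bigcup_k [set w | tree N w = e k /\ nvertices (e k) <> N]).
  apply: negligibleS => w /= nN; have [k ek] := eP (tree N w); exists k => //=.
  by rewrite ek; split=> // E; apply: nN => _.
apply: negligible_bigcup => k; have [E|/eqP nE] := pselect (nvertices (e k) = N).
  by apply: (negligibleS _ (negligible_set0 P)) => w [_ /(_ E)].
have [mE pE] := htreeN (e k).
exists [set w | tree N w = e k]; split=> //; last by move=> w [].
by apply: etrans pE _; rewrite (negbTE nE).
Qed.

(** * Uniform convergence *)

Section PathConvergence.
Variable R : realType.

Definition unif_close (f_ : nat -> R -> R) (f : R -> R) : Prop :=
  forall eps, 0 < eps -> \forall N \near \oo,
    forall t, t \in `[0, 1] -> `|f_ N t - f t| < eps.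

Definition unif_continuous01 (f : R -> R) : Prop :=
  forall eps, 0 < eps -> exists2 delta, 0 < delta &
    forall s t, s \in `[0, 1] -> t \in `[0, 1] ->
      `|s - t| < delta -> `|f s - f t| < eps.

Lemma uniform_cvg_close (f_ : nat -> R -> R) f :
  {uniform `[0, 1], f_ @ \oo --> f} -> unif_close f_ f.
Proof.
move=> cvgf eps eps0.
apply: (cvgf [set h | forall t, t \in `[0, 1] -> `|h t - f t| < eps]).
apply/uniform_nbhs; exists [set xy | `|xy.1 - xy.2| < eps]; split.
  by rewrite -entourage_ballE; exists eps.
by move=> h fh t t01; rewrite distrC; apply: fh.
Qed.

Lemma continuous_unif_continuous01 (f : R -> R) :
  {within `[0, 1], continuous f} -> unif_continuous01 f.
Proof.
move=> /subspace_continuousP cf eps eps0.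
have cfx (x e : R) : x \in `[0, 1] -> 0 < e -> exists2 r : R, 0 < r &
    forall s : R, s \in `[0, 1] -> `|x - s| < r -> `|f x - f s| < e.
  move=> x01 e0; have /cvgrPdist_lt/(_ e e0)/nbhs_ballP[r /= r0 rP] := cf x x01.
  by exists r => // s s01 xs; apply: rP.
have tri (a b c e : R) : `|a - b| < e / 2 -> `|b - c| < e / 2 -> `|a - c| < e.
  by move=> ab bc; rewrite -(subrKA b) (le_lt_trans (ler_normD _ _))//; lra.
have /compact_near_coveringP covK := @segment_compact R 0 1.
(* Some radius [d] works for all points near a given one, and compactness makes it uniform. Nearby
   points may leave [0, 1], hence the premise on [x]. *)
have [|delta /= delta0 dP] := covK R 0^'+ (fun d x => x \in `[0, 1] ->
    forall s, s \in `[0, 1] -> `|s - x| < d -> `|f s - f x| < eps) _.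
  move=> x x01; have [|r r0 rP] := cfx x (eps / 2) x01; first by rewrite divr_gt0.
  near=> x' d => /= x'01 s s01 sx'.
  have xx' : `|x - x'| < r / 2.
    by near: x'; apply: nbhsx_ballx; rewrite divr_gt0.
  have dr : d < r / 2 by near: d; apply: nbhs_right_lt; rewrite divr_gt0.
  apply: (tri _ (f x)); last first.
    by apply: rP => //; apply: lt_trans xx' _; rewrite ltr_pdivrMr// ltr_pMr// ltr1n.
  rewrite distrC; apply: rP => //; apply: (tri _ x') => //.
  by rewrite distrC; apply: lt_trans sx' dr.
exists (delta / 2); first by rewrite divr_gt0.
move=> s t s01 t01; apply: dP => //=; last by rewrite divr_gt0.
by rewrite sub0r normrN gtr0_norm ?divr_gt0// ltr_pdivrMr// ltr_pMr// ltr1n.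
Unshelve. all: by end_near. Qed.

Lemma unif_continuous01_rev f :
  unif_continuous01 f -> unif_continuous01 (fun t => f (1 - t)).
Proof.
move=> cf eps /cf[delta delta0 dP]; exists delta => // s t.
rewrite !in_itv /= => s01 t01 st.
apply: dP; rewrite ?in_itv /=; [lra|lra|].
by rewrite (_ : _ - _ = t - s) 1?distrC//; lra.
Qed.

(** Write t as the image of s under the time change: [f_ N t] is close to [f s], and s is close to
    t, so [f s] is close to [f t]. *)
Lemma J1_cvg_close (f_ : nat -> R -> R) f :
  unif_continuous01 f -> J1_cvg f_ f -> unif_close f_ f.
Proof.
move=> cf [lambda [lambdaP /uniform_cvg_close lambda_id /uniform_cvg_close fl]].
move=> eps eps0; have eps20 : 0 < eps / 2 by rewrite divr_gt0.
have [delta delta0 dP] := cf _ eps20.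
move: (lambda_id _ delta0) (fl _ eps20).
apply: filterS2 => N lambdaN flN t t01.
have [[_ _ surj_l] _] := lambdaP N.
have [s s01 ts] := surj_l t t01.
have st := lambdaN s s01; have fst := flN s s01.
rewrite /= ts in st fst.
have ff : `|f s - f t| < eps / 2 by apply: dP => //; rewrite distrC.
by rewrite -(subrKA (f s)) (le_lt_trans (ler_normD _ _))//; lra.
Qed.
End PathConvergence.

Lemma unit_fraction_itv (R : realType) n N :
  (n <= N)%N -> n%:R / N%:R \in (`[0, 1] : interval R).
Proof.
move=> nN; rewrite in_itv /= divr_ge0 //=.
have [->|N0] := posnP N; first by rewrite invr0 mulr0.
by rewrite ler_pdivrMr ?ltr0n// mul1r ler_nat.
Qed.

(** For c = 1 the ratio tends to 1, yet it is 0 wherever [ell] vanishes, as [0^-1 = 0]. *)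
Lemma slowly_varying_neq0 (R : realType) (ell : R -> R) :
  slowly_varying ell -> \forall N \near \oo, ell N%:R != 0.
Proof.
move=> [_ _ /(_ 1 ltr01) lim1].
have near_neq0 : \forall x \near +oo, ell x != 0.
  suff : \forall x \near +oo, ell (1 * x) / ell x != 0.
    by apply: filterS => x /=; apply: contra_neq => ->; rewrite invr0 mulr0.
  by apply: cvgr_neq0 lim1 _; exact: oner_neq0.
exact: (@cvgr_idn R _ near_neq0).
Qed.

Lemma scale_ab (R : realType) (ell : R -> R) N : (0 < N)%N -> ell N%:R != 0 ->
  scale_a ell N * scale_b ell N * N%:R = 1.
Proof.
move=> N0 ellN; rewrite /scale_a /scale_b.
have NE : N%:R = N%:R `^ 2^-1 * N%:R `^ 2^-1 :> R.
  rewrite -powRD; last by rewrite pnatr_eq0 -lt0n N0 implybT.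
  by rewrite (_ : 2^-1 + 2^-1 = 1) ?powRr1//; lra.
have p0 : N%:R `^ 2^-1 != 0 :> R by rewrite lt0r_neq0// powR_gt0// ltr0n.
rewrite (_ : 2^-1 - 1 = - 2^-1 :> R); last by lra.
rewrite !powRN [X in _ * X = 1]NE; field.
by rewrite p0.
Qed.

(** * The limit for one realization of the trees *)

Section DeterministicLimit.
Variables (R : realType) (ell : R -> R) (T : nat -> plane_tree) (X : R -> R).
Hypothesis ell_slow : slowly_varying ell.
Hypothesis sizeT : \forall N \near \oo, nvertices (T N) = N.
Hypothesis cX : {within `[0, 1], continuous X}.
Hypothesis X1 : X 1 = 0.
Hypothesis cvgT : coding_paths_cvg ell T X.

Let ucX : unif_continuous01 X := continuous_unif_continuous01 cX.

Let b N := scale_b ell N.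
Let up N n : R := @total_excess R (T N) (take n (lex_vertices (T N))).
Let down N n : R := @total_excess R (T N) (take n (revlex_vertices (T N))).

(** The path is sampled at t = n / N, where the truncation of N t is exactly [n]; n = N gives its
    endpoint. *)
Lemma luka_path_close (s : nat -> seq vertex) (f : R -> R) :
  (\forall N \near \oo, size (s N) = N) ->
  unif_continuous01 f ->
  J1_cvg (fun N t => b N *
    walk (fun k => (nchildren (T N) (nth [::] (s N) k))%:R - 1 : R)
      (Num.truncn (N%:R * t))) f ->
  forall eps, 0 < eps -> \forall N \near \oo, forall n, (n <= N)%N ->
    `|b N * @total_excess R (T N) (take n (s N)) - f (n%:R / N%:R)| < eps.
Proof.
move=> sN ucf /(J1_cvg_close ucf) cl eps /cl; move: sN.
have N0 : \forall N \near \oo, (0 < N)%N by exists 1%N.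
move: N0; apply: filterS3 => N N0 sN fN n nN.
have NnE : N%:R * (n%:R / N%:R) = n%:R :> R.
  by rewrite mulrC divfK// pnatr_eq0 -lt0n.
by have := fN _ (unit_fraction_itv R nN); rewrite /= NnE natrK walkE ?sN.
Qed.

Lemma up_close eps : 0 < eps -> \forall N \near \oo, forall n, (n <= N)%N ->
  `|b N * up N n - X (n%:R / N%:R)| < eps.
Proof.
case: cvgT => _ _ cl _.
exact: (@luka_path_close (fun N => lex_vertices (T N)) X).
Qed.

Lemma down_close eps : 0 < eps -> \forall N \near \oo, forall n, (n <= N)%N ->
  `|b N * down N n - X (1 - n%:R / N%:R)| < eps.
Proof.
case: cvgT => _ _ _ cl.
apply: (@luka_path_close (fun N => revlex_vertices (T N)) (fun t => X (1 - t))) => //.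
  apply: filterS sizeT => N sN; rewrite -[RHS]sN.
  exact/perm_size/perm_revlex_vertices.
exact: unif_continuous01_rev.
Qed.

(* The Lukasiewicz path ends at -1, while the excursion ends at 0. *)
Lemma scale_b_to0 eps : 0 < eps -> \forall N \near \oo, `|b N| < eps.
Proof.
move=> /up_close upN.
have N0 : \forall N \near \oo, (0 < N)%N by exists 1%N.
move: N0 sizeT upN; apply: filterS3 => N N0 sN /(_ N (leqnn N)).
rewrite divff ?pnatr_eq0 -?lt0n// X1 subr0 /up -[in take N]sN take_size.
by rewrite total_excess_lex mulrN1 normrN.
Qed.

(** A height h satisfies h / N = (a_N h) b_N, where a_N h stays bounded and b_N tends to 0. *)
Lemma height_negligible (eps : R) : 0 < eps -> \forall N \near \oo,
  forall n, (n < N)%N ->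
    (size (nth [::] (lex_vertices (T N)) n))%:R / N%:R < eps.
Proof.
move=> eps0; case: cvgT => _ /uniform_cvg_close clH _ _.
have [c _ Xmax] := EVT_max (@ler01 R) cX.
set M := X c in Xmax.
(* The limit 2 X is at most 2 [M], and 1 is the error allowed in the convergence of the heights. *)
pose K := 1 + 2 * `|M|.
have K0 : 0 < K by rewrite ltr_wpDr// mulr_ge0.
have ebK : 0 < eps / K by rewrite divr_gt0.
have near_N : \forall N \near \oo, (1 < N)%N /\ ell N%:R != 0.
  by apply: filterI; [exists 2%N|exact: slowly_varying_neq0].
move: near_N (clH 1 (@ltr01 R)) (scale_b_to0 ebK).
apply: filterS3 => N [N1 ellN] clN bN n nN.
have N0 : 0 < N%:R :> R by rewrite ltr0n ltnW.
have P0 : N.-1%:R != 0 :> R by rewrite pnatr_eq0; lia.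
have nP : (n <= N.-1)%N by lia.
have /clN := unit_fraction_itv R nP.
(* The height process is read at time n / (N - 1), hence at the integer [n], where the interpolation
   term vanishes. *)
rewrite [X in height _ X]mulrC divfK// /height /linear_interp natrK subrr mul0r addr0.
set h := _%:R; move=> /ltr_distlDr aH.
have aHK : scale_a ell N * h < K.
  have := Xmax _ (unit_fraction_itv R nP); have := ler_norm M; rewrite /K; lra.
have ab1 := scale_ab (ltnW N1) ellN.
have -> : h / N%:R = scale_a ell N * h * scale_b ell N.
  rewrite -[LHS]mulr1 -[X in _ * X = _]ab1; field; exact: lt0r_neq0.
have ell0 : 0 <= ell N%:R by case: ell_slow => + _ _; apply; exact: ltW.
have ah0 : 0 <= scale_a ell N * h by rewrite !mulr_ge0 ?powR_ge0.
have b0 : 0 <= b N by rewrite mulr_ge0 ?invr_ge0 ?powR_ge0.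
apply: (@le_lt_trans _ _ (K * b N)); first by rewrite ler_wpM2r// ltW.
by rewrite mulrC -ltr_pdivlMr// (le_lt_trans (ler_norm _)).
Qed.

Lemma sigma_up_close : unif_close (fun N t => b N * sigma_up (T N) N t)
  (fun t => 2 * X t).
Proof.
(* The errors add up to at most 11 e: 2 e for [up N n], 6 e for [down N n'] and 3 e for the
   contribution of [u]. *)
move=> eps eps0; pose e := eps / 20.
have e0 : 0 < e by rewrite divr_gt0.
have [delta delta0 dP] := ucX e0.
have near_N : \forall N \near \oo, [/\ nvertices (T N) = N, delta^-1 < N%:R,
    `|b N| < e & forall n, (n < N)%N ->
      (size (nth [::] (lex_vertices (T N)) n))%:R / N%:R < delta].
  near=> N; split; near: N => //.
  - exact: nbhs_infty_gtr.
  - exact: scale_b_to0.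
  - exact: height_negligible.
move: near_N (up_close e0) (down_close e0).
apply: filterS3 => N [sN N1 bN hN] upN downN t t01.
have NR0 : 0 < N%:R :> R by apply: lt_trans N1; rewrite invr_gt0.
have N0 : (0 < N)%N by rewrite -(ltr0n R).
(* Moving by one index changes the time by less than [delta]. *)
have N1d : N%:R^-1 < delta by rewrite invf_plt.
rewrite /sigma_up; have [t1|] := ltP t 1; last first.
  move=> t1; have -> : t = 1 by move: t01; rewrite in_itv /=; lra.
  by rewrite X1 !mulr0 subr0 normr0.
have t0 : 0 <= t by move: t01; rewrite in_itv /= => /andP[].
set n := Num.truncn _.
have /andP[nle nlt] : n%:R <= N%:R * t < n.+1%:R.
  by apply: truncn_itv; rewrite mulr_ge0// ltW.
have nN : (n < N)%N.
  by rewrite -(ltr_nat R); apply: le_lt_trans nle _; rewrite gtr_pMr.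
have Xclose i j : (i <= N)%N -> (j <= N)%N -> `|i%:R - j%:R| < N%:R * delta ->
    `|X (i%:R / N%:R) - X (j%:R / N%:R)| < e.
  move=> iN jN ij; apply: dP; try exact: unit_fraction_itv.
  by rewrite -mulrBl normrM (gtr0_norm (x := N%:R^-1)) ?invr_gt0//
    ltr_pdivrMr// mulrC.
have Nd1 : 1 < N%:R * delta by rewrite -ltr_pdivrMr// div1r.
have Xn : `|X (n%:R / N%:R) - X t| < e.
  apply: dP => //; first by rewrite unit_fraction_itv// ltnW.
  have -> : n%:R / N%:R - t = (n%:R - N%:R * t) / N%:R.
    by rewrite mulrBl mulrAC divff ?mul1r// lt0r_neq0.
  rewrite normrM (gtr0_norm (x := N%:R^-1)) ?invr_gt0// ltr_pdivrMr//.
  rewrite ler0_norm ?subr_le0// opprB mulrC.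
  by rewrite -natr1 in nlt; move: Nd1; rewrite mulrC; lra.
have [|n' [m [n'N mN nmE upE ancE]]] := @ancestral_excess_decomposition R (T N) n.
  by rewrite sN.
rewrite sN in n'N mN nmE.
set u := nth _ _ n in nmE ancE *.
rewrite -[X in b N * X]/(ancestral_excess R (T N) u) ancE.
rewrite -/(up N n) -/(down N n'); rewrite -/(up N m) -/(up N n) in upE.
have upn := upN n (ltnW nN); have upn1 := upN n.+1 nN; have upm := upN m mN.
have downn' := downN n' n'N.
(* Unless [u] is a leaf, this is the increment of the path after [n]: two approximation errors and
   one oscillation of [X]. *)
have jump :
    `|b N * (if nchildren (T N) u == 0%N then 0 else excess R (T N) u)| < 3 * e.
  have Xnn1 : `|X (n.+1%:R / N%:R) - X (n%:R / N%:R)| < e.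
    by apply: Xclose => //; [exact: ltnW|rewrite -natr1 addrAC subrr add0r normr1].
  case: ifP => _; first by rewrite mulr0 normr0 mulr_gt0.
  have upS : up N n.+1 = up N n + excess R (T N) u.
    rewrite /up (take_nth [::]); last by rewrite -/(nvertices _) sN.
    by rewrite -cats1 total_excess_cat /total_excess big_seq1.
  have -> : b N * excess R (T N) u = b N * up N n.+1 - b N * up N n.
    by rewrite upS; ring.
  rewrite ltr_norml; move: upn upn1 Xnn1; rewrite !ltr_norml; lra.
have Xdown : `|X (1 - n'%:R / N%:R) - X (m%:R / N%:R)| < e.
  apply: dP; try exact: unit_fraction_itv.
    have := unit_fraction_itv R n'N; rewrite !in_itv /=; lra.
  have -> : 1 - n'%:R / N%:R - m%:R / N%:R = - ((size u)%:R / N%:R) :> R.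
    have : n'%:R + m%:R = N%:R + (size u)%:R :> R by rewrite -!natrD nmE.
    move=> /(congr1 (fun x => x / N%:R)); rewrite !mulrDl divff ?lt0r_neq0//; lra.
  by rewrite normrN ger0_norm ?divr_ge0// hN.
have bup : b N * up N m = b N * up N n - b N by rewrite upE mulrBr mulr1.
rewrite !mulrDr; move: jump; set J := b N * (if _ then _ else _).
rewrite bup in upm.
have epsE : eps = 20 * e by rewrite /e; lra.
rewrite epsE; move: upn upm downn' Xdown Xn bN; rewrite !ltr_norml; lra.
Unshelve. all: by end_near. Qed.

End DeterministicLimit.

(** The supremum may be infinite for small N; eventually it lies between 0, by the point t = 0, and
    [eps]. *)
Lemma ereal_sup_dist_cvg0 (R : realType) (f_ : nat -> R -> R) (f : R -> R) :
  unif_close f_ f ->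
  ereal_sup [set `|f_ N t - f t|%:E | t in `[0, 1]] @[N --> \oo] --> 0%E.
Proof.
move=> fP.
have supP (eps : R) : 0 < eps -> \forall N \near \oo,
    (0 <= ereal_sup [set `|f_ N t - f t|%:E | t in `[0%R, 1%R]] <= eps%:E)%E.
  move=> /fP; apply: filterS => N fN; apply/andP; split.
    apply: (@le_trans _ _ `|f_ N 0 - f 0|%:E); first by rewrite lee_fin.
    by apply: ereal_sup_ubound; exists 0 => //=; rewrite in_itv /= lexx ler01.
  by apply: ge_ereal_sup => _ [t t01 <-]; rewrite lee_fin ltW// fN.
apply/fine_cvgP; split.
  apply: filterS (supP _ (@ltr01 R)) => N /andP[ge0 le1].
  by rewrite fin_numElt (lt_le_trans _ ge0) ?ltNyr// (le_lt_trans le1) ?ltry.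
apply/cvgrPdist_le => eps /supP; apply: filterS => N /= /andP[ge0 lee].
rewrite sub0r normrN ger0_norm ?fine_ge0//.
by rewrite -lee_fin fineK// fin_numElt (lt_le_trans _ ge0) ?ltNyr//
  (le_lt_trans lee) ?ltry.
Qed.

Unset Implicit Arguments.

Theorem theorem3p3 (R : realType) (d : measure_display)
    (Omega : measurableType d) (P : probability Omega R)
    (eta : nat -> R) (ell : R -> R)
    (tree : nat -> Omega -> plane_tree) (X2 : Omega -> R -> R)
    (heta : critical_stable2_offspring eta)
    (hell : slowly_varying ell)
    (htree : conditioned_gw_trees P eta tree)
    (hX2 : brownian_excursion P X2)
    (hcvg : \forall w \ae P,
       coding_paths_cvg ell (fun N => tree N w) (X2 w)) :
  \forall w \ae P,
    ereal_sup [set `|scale_b ell N * sigma_up (tree N w) N t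
                     - 2 * X2 w t|%:E | t in `[0, 1]]
      @[N --> \oo] --> 0%E.
Proof.
move: (ae_nvertices heta htree) (excursion_paths hX2) hcvg.
apply: filterS3 => w sizeN [cX _ X1] cvgN.
exact/ereal_sup_dist_cvg0/sigma_up_close.
Qed.
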